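(* Let $\mathfrak b\subset\mathfrak a$ be homogeneous Gorenstein ideals of grades $g-1$ and $g$ in the graded Gorenstein ring $R$, with $d=u-v\ge0$, and let $y$, $\omega$, $f$ be as described in the context. The homogeneous Gorenstein ideal $I=(\mathfrak b,\ \alpha_{g-1}^*+(-1)^gfa_g^* )$ produced from these data by the two-link construction described in the context is obtained from $\mathfrak a$ by an elementary biliaison on $\mathfrak b$.
   Context: Conventions: $R=\bigoplus_{j\ge0}[R]_j$ is a commutative Noetherian graded Gorenstein ring, generated as an $[R]_0$-algebra by $[R]_1$, with $[R]_0$ a field, and $\mathfrak m$ is its maximal homogeneous ideal. Only homogeneous ideals are considered. $M(s)$ denotes $M$ with grading $[M(s)]_j=[M]_{s+j}$. A Gorenstein ideal is a perfect ideal $\mathfrak c$ such that $R/\mathfrak c$ is Gorenstein. Ideals $I,J$ are linked by a Gorenstein ideal $\mathfrak c$, written $I\sim_{\mathfrak c}J$, if $\mathfrak c\subset I\cap J$, $\mathfrak c:I=J$ and $\mathfrak c:J=I$. The canonical module $\omega_M$ of a graded module $M$ is the graded $[R]_0$-dual of $H^{\dim M}_{\mathfrak m}(M)$. Elementary biliaison: suppose $J\subset I\cap K$ are homogeneous ideals in $R$ with $\operatorname{grade}(I)=\operatorname{grade}(J)+1$, and $J$ is Cohen–Macaulay and generically Gorenstein. If there is an isomorphism of graded $R$-modules $(I/J)(-s)\cong K/J$ (for some integer $s$), then $K$ is said to be obtained from $I$ by an elementary biliaison on $J$. Setting: $\mathfrak b\subset\mathfrak a$ are homogeneous Gorenstein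 ideals with $\operatorname{grade}\mathfrak b=g-1$, $\operatorname{grade}\mathfrak a=g$, and graded minimal free resolutions $$\mathbb A:\ 0\to A_g=R(-v)\xrightarrow{a_g}A_{g-1}\to\cdots\to A_1\xrightarrow{a_1}R\to0,$$ $$\mathbb B:\ 0\to B_{g-1}=R(-u)\xrightarrow{b_{g-1}}B_{g-2}\to\cdots\to B_1\xrightarrow{b_1}R\to0$$ of $R/\mathfrak a$ and $R/\mathfrak b$. The embedding $\mathfrak b\hookrightarrow\mathfrak a$ induces a comparison map $\alpha=(\alpha_i:B_i\to A_i)$ with $\alpha_0=\mathrm{id}$; bases are fixed and maps identified with matrices. Assume $d=u-v\ge0$. The element $y\in\mathfrak a$ is homogeneous with $\mathfrak b:y=\mathfrak b$. The embedding $(\mathfrak b,y)\hookrightarrow\mathfrak a$ induces an $R$-module homomorphism $\omega_{R/\mathfrak a}\to\omega_{R/(\mathfrak b,y)}$ that is multiplication by some homogeneous element $\omega\in R$, of degree $d+\deg y$. The element $f\in R$ is homogeneous of degree $d$ with $\mathfrak b:(\omega+fy)=\mathfrak b$. The ideal $I$ is obtained from $\mathfrak a$ by the two links $\mathfrak a\sim_{(\mathfrak b,y)}J\sim_{(\mathfrak b,\omega+fy)}I$, that is, $I=(\mathfrak b,\omega+fy):[(\mathfrak b,y):\mathfrak a]$. It is a theorem about this setting that $I$ is a Gorenstein ideal of grade $g$ and $I=\mathfrak b+(\alpha_{g-1}^*+(-1)^gfa_g^* )=(\mathfrak b,\alpha_{g-1}^*+(-1)^gfa_g^* )$, where $\alpha_{g-1}^*$,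 $a_g^*$ are interpreted as row vectors and the entries of their component-wise sum, together with generators of $\mathfrak b$, generate $I$. *)

(* Defs.v *)
From HB Require Import structures.
From mathcomp Require Import all_boot all_order all_algebra.
From mathcomp Require Import ring_quotient.
From mathcomp Require Import boolp classical_sets.

Set Implicit Arguments.
Unset Strict Implicit.
Unset Printing Implicit Defensive.

Import GRing.Theory.
Local Open Scope classical_set_scope.
Local Open Scope quotient_scope.
Local Open Scope ring_scope.

(* Submodules are the boolean predicates [submodClosed M]; classical logic makes
   every submodule such a predicate.  Ideals need not be proper. *)
Notation ideal R := (submodClosed R^o).

Section SubQuotient.
Variables (R : comNzRingType) (M : lmodType R).
Implicit Type N : submodClosed M.

Definition span (S : set M) : {pred M} :=
  fun x => `[< forall N, (forall s, S s -> s \in N) -> x \in N >].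

Fact span_submod_closed S : submod_closed (span S).
Proof.
split=> [|r x y /asboolP xS /asboolP yS].
  by apply/asboolP => N _; apply: rpred0.
by apply/asboolP => N NS; rewrite rpredD ?rpredZ ?xS ?yS.
Qed.
HB.instance Definition _ S :=
  GRing.isSubmodClosed.Build R M (span S) (span_submod_closed S).

Definition submod N : Type := {x : M | x \in N}.
HB.instance Definition _ N := SubType.on (submod N).
HB.instance Definition _ N := Choice.on (submod N).
HB.instance Definition _ N := [SubChoice_isSubLmodule of submod N by <:].

(* [submodClosed] does not record closure under opposites, which [Quotient]
   requires. *)
Definition zpred N : {pred M} := fun x => x \in N.
Fact zpred_zmod_closed N : zmod_closed (zpred N).
Proof.
split=> [|x y xN yN]; first exact: rpred0.
by rewrite [_ \in _]rpredD // -scaleN1r rpredZ.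
Qed.
HB.instance Definition _ N :=
  GRing.isZmodClosed.Build M (zpred N) (zpred_zmod_closed N).

Definition qmod N : Type := @Quotient.quot M (zpred N).
HB.instance Definition _ N := GRing.Zmodule.on (qmod N).

Definition qmod_pi N (x : M) : qmod N := \pi_(@Quotient.quot M (zpred N)) x.

Definition qmod_scale N (r : R) (q : qmod N) : qmod N :=
  qmod_pi N (r *: repr (q : @Quotient.quot M (zpred N))).

Fact qmod_piE N x y : (qmod_pi N x == qmod_pi N y) = (x - y \in N).
Proof. by rewrite [LHS]piE. Qed.

Fact qmod_pi_ind N (P : qmod N -> Prop) :
  (forall x, P (qmod_pi N x)) -> forall q, P q.
Proof.
move=> HP q; have := HP (repr (q : @Quotient.quot M (zpred N))).
by rewrite /qmod_pi reprK.
Qed.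

Fact qmod_piZ N r x : qmod_scale r (qmod_pi N x) = qmod_pi N (r *: x).
Proof.
apply/eqP; rewrite qmod_piE -scalerBr rpredZ // -qmod_piE.
by rewrite /qmod_pi reprK.
Qed.

Fact qmod_piD N x y : qmod_pi N (x + y) = qmod_pi N x + qmod_pi N y.
Proof. exact: (raddfD (\pi_(@Quotient.quot M (zpred N)))). Qed.

Fact qmod_scaleA N r s (q : qmod N) :
  qmod_scale r (qmod_scale s q) = qmod_scale (r * s) q.
Proof. by elim/qmod_pi_ind: q => x; rewrite !qmod_piZ scalerA. Qed.
Fact qmod_scale1 N : left_id 1 (@qmod_scale N).
Proof. by elim/qmod_pi_ind=> x; rewrite qmod_piZ scale1r. Qed.
Fact qmod_scaleDr N : right_distributive (@qmod_scale N) +%R.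
Proof.
move=> r; elim/qmod_pi_ind=> x; elim/qmod_pi_ind=> y.
by rewrite -qmod_piD !qmod_piZ scalerDr qmod_piD.
Qed.
Fact qmod_scaleDl N q : {morph (@qmod_scale N)^~ q : r s / r + s}.
Proof.
by elim/qmod_pi_ind: q => x r s; rewrite !qmod_piZ scalerDl qmod_piD.
Qed.
HB.instance Definition _ N := GRing.Zmodule_isLmodule.Build R (qmod N)
  (@qmod_scaleA N) (@qmod_scale1 N) (@qmod_scaleDr N) (@qmod_scaleDl N).

Fact qmod_pi_linear N : linear (qmod_pi N).
Proof. by move=> r x y; rewrite qmod_piD -qmod_piZ. Qed.
HB.instance Definition _ N :=
  GRing.isLinear.Build R M (qmod N) _ (qmod_pi N) (@qmod_pi_linear N).

(* The trace of D on the module N; N/D is meant for D contained in N. *)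
Definition trace N (D : submodClosed M) : {pred submod N} :=
  [pred x | val x \in D].
Fact trace_submod_closed N (D : submodClosed M) : submod_closed (@trace N D).
Proof.
split=> [|r x y]; rewrite !inE; first by rewrite (raddf0 val) rpred0.
by move=> xD yD; rewrite (linearP (val : {linear submod N -> M})) rpredD ?rpredZ.
Qed.
HB.instance Definition _ N D :=
  GRing.isSubmodClosed.Build R (submod N) (@trace N D) (trace_submod_closed N D).

End SubQuotient.
Arguments trace {R M} N D _.

Definition subquot (R : comNzRingType) (M : lmodType R) (N D : submodClosed M) :
    lmodType R :=
  qmod (trace N D).

Section RingNotions.
Variable R : comNzRingType.
Implicit Types (I J c : ideal R) (P : ideal R).

Definition idealD I (S : set R) : ideal R :=
  span ([set x : R^o | x \in I] `|` S).

Definition zero_ideal : ideal R := span (set0 : set R^o).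

Definition colon I (S : set R) : {pred R^o} :=
  fun x => `[< forall s, S s -> (x : R) * s \in I >].
Fact colon_submod_closed I S : submod_closed (colon I S).
Proof.
split=> [|r x y /asboolP xS /asboolP yS]; apply/asboolP => s Ss.
  by rewrite mul0r; apply: (rpred0 I).
rewrite mulrDl -mulrA; apply: (rpredD (S := I)); last exact: yS.
exact: (rpredZ (s := I) r (xS s Ss)).
Qed.
HB.instance Definition _ I S :=
  GRing.isSubmodClosed.Build R R^o (colon I S) (colon_submod_closed I S).

Definition noetherian : Prop :=
  forall I, exists xs : seq R, I =i span ([set` xs] : set R^o).

Definition prime_ideal P : Prop :=
  1 \notin P /\ forall x y : R, x * y \in P -> x \in P \/ y \in P.

Definition minimal_prime I P : Prop :=
  [/\ prime_ideal P, {subset I <= P} &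
      forall Q : ideal R,
        prime_ideal Q -> {subset I <= Q} -> {subset Q <= P} -> Q =i P].

Definition prime_chain I (n : nat) : Prop :=
  exists p : nat -> ideal R,
    [/\ forall i, (i <= n)%N -> prime_ideal (p i),
        {subset I <= p 0%N} &
        forall i, (i < n)%N -> {subset p i <= p i.+1} /\ ~ (p i =i p i.+1)].

(* Krull dimension of R/I *)
Definition dim_is I (n : nat) : Prop :=
  prime_chain I n /\ forall k, prime_chain I k -> (k <= n)%N.

Definition regular_seq (xs : seq R) : Prop :=
  (forall i (r : R), (i < size xs)%N ->
     xs`_i * r \in span ([set` take i xs] : set R^o) ->
     r \in span ([set` take i xs] : set R^o)) /\
  1 \notin span ([set` xs] : set R^o).

(* grade of I : the maximal length of an R-regular sequence in I *)
Definition grade_is (I : set R) (n : nat) : Prop :=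
  (exists xs, [/\ regular_seq xs, forall x, x \in xs -> I x & size xs = n]) /\
  forall xs, regular_seq xs -> (forall x, x \in xs -> I x) -> (size xs <= n)%N.

Definition ideal_grade I (n : nat) : Prop := grade_is [set x : R | x \in I] n.

(* The maximal ideal of R, when R is local. *)
Definition nonunits : set R := [set x | ~ exists y, x * y = 1].

(* The local ring R is Cohen-Macaulay: depth R = dim R. *)
Definition local_CM : Prop :=
  exists n, grade_is nonunits n /\ dim_is zero_ideal n.

(* The local ring R is Gorenstein: it is Cohen-Macaulay of type one, i.e. the
   socle ((xs) : m) / (xs) of R/(xs) is one-dimensional over R/m for a
   maximal regular sequence xs. *)
Definition local_Gorenstein : Prop :=
  local_CM /\
  exists xs : seq R,
    [/\ regular_seq xs, forall x, x \in xs -> nonunits x,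
        grade_is nonunits (size xs) &
        let q : ideal R := span ([set` xs] : set R^o) in
        exists s : R, s \notin q /\ colon q nonunits =i idealD q [set s]].
End RingNotions.

(* phi exhibits B as the localization (R/c)_P, for a prime P containing c. *)
Definition localization (R : comNzRingType) (c P : ideal R)
    (B : comNzRingType) (phi : {rmorphism R -> B}) : Prop :=
  [/\ forall s, s \notin P -> exists t, phi s * t = 1,
      forall x, exists r s, s \notin P /\ phi s * x = phi r &
      forall r, phi r = 0 <-> exists s : R, s \notin P /\ s * r \in c].

Definition localizations_satisfy (R : comNzRingType) (c P : ideal R)
    (prop : comNzRingType -> Prop) : Prop :=
  forall (B : comNzRingType) (phi : {rmorphism R -> B}),
    localization c P phi -> prop B.

Section IdealNotions.
Variable R : comNzRingType.
Implicit Types (I c : ideal R).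

(* The ring R/c is Cohen-Macaulay. *)
Definition CM_ideal c : Prop :=
  forall P : ideal R, prime_ideal P -> {subset c <= P} ->
    localizations_satisfy c P local_CM.

(* The ring R/c is Gorenstein. *)
Definition Gorenstein_quotient c : Prop :=
  forall P : ideal R, prime_ideal P -> {subset c <= P} ->
    localizations_satisfy c P local_Gorenstein.

Definition generically_Gorenstein c : Prop :=
  forall P : ideal R, minimal_prime c P ->
    localizations_satisfy c P local_Gorenstein.

Definition projective (P : lmodType R) : Prop :=
  forall (M N : lmodType R) (p : {linear M -> N}) (f : {linear P -> N}),
    (forall y, exists x, p x = y) ->
    exists g : {linear P -> M}, forall x, p (g x) = f x.

Definition pd_le (M : lmodType R) (n : nat) : Prop :=
  exists (P : nat -> lmodType R) (d : forall i, {linear P i.+1 -> P i})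
         (eps : {linear P 0%N -> M}),
    [/\ forall i, projective (P i),
        forall x, exists y, eps y = x,
        forall x, eps x = 0 <-> exists y, d 0%N y = x,
        forall i x, d i x = 0 <-> exists y, d i.+1 y = x &
        forall i, (n < i)%N -> forall x : P i, x = 0].

Definition pd_is (M : lmodType R) (n : nat) : Prop :=
  pd_le M n /\ forall k, pd_le M k -> (n <= k)%N.

Definition perfect_ideal c : Prop :=
  1 \notin c /\ exists n, ideal_grade c n /\ pd_is (qmod c) n.

Definition Gorenstein_ideal c : Prop := perfect_ideal c /\ Gorenstein_quotient c.
End IdealNotions.

Section Graded.

(* V is the direct sum of its subgroups [gr j]. *)
Record grading (V : zmodType) (gr : int -> set V) : Prop := Grading {
  gr_0 : forall j, gr j 0;
  gr_B : forall j x y, gr j x -> gr j y -> gr j (x - y);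
  gr_span : forall x, exists (s : seq int) (xc : int -> V),
    (forall j, gr j (xc j)) /\ x = \sum_(j <- s) xc j;
  gr_free : forall (s : seq int) (xc : int -> V),
    uniq s -> (forall j, gr j (xc j)) -> \sum_(j <- s) xc j = 0 ->
    forall j, j \in s -> xc j = 0 }.

Variables (R : comNzRingType) (gr : nat -> set R).

Definition zgr (j : int) : set R :=
  match j with Posz n => gr n | Negz _ => [set 0] end.

Record standard_graded : Prop := StandardGraded {
  sg_grading : grading zgr;
  sg_1 : gr 0%N 1;
  sg_M : forall i j x y, gr i x -> gr j y -> gr (i + j)%N (x * y);
  sg_field : forall x, gr 0%N x -> x != 0 -> exists2 y, gr 0%N y & x * y = 1;
  sg_gen : forall S : set R,
    (forall x y, S x -> S y -> S (x - y)) ->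
    (forall x y, S x -> S y -> S (x * y)) ->
    (forall x, gr 0%N x -> S x) -> (forall x, gr 1%N x -> S x) ->
    forall x, S x }.

Definition irrelevant_ideal : ideal R :=
  span ([set x : R^o | exists2 j, (0 < j)%N & gr j x]).

Record graded_module (M : lmodType R) (grM : int -> set M) : Prop :=
  GradedModule {
    gm_grading : grading grM;
    gm_Z : forall i j r x, gr i r -> grM j x -> grM (Posz i + j)%R (r *: x) }.

Definition homogeneous (I : ideal R) : Prop :=
  forall x, x \in I -> exists (s : seq int) (xc : int -> R),
    [/\ forall j, zgr j (xc j), forall j, xc j \in I & x = \sum_(j <- s) xc j].

Definition shift (M : lmodType R) (grM : int -> set M) (s : int) : int -> set M :=
  fun j => grM (s + j).

Definition qmod_gr (M : lmodType R) (N : submodClosed M) (grM : int -> set M) :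
    int -> set (qmod N) :=
  fun j => [set qmod_pi N x | x in grM j].

Definition subquot_gr (M : lmodType R) (N D : submodClosed M)
    (grM : int -> set M) : int -> set (subquot N D) :=
  qmod_gr (fun j => [set x : submod N | grM j (val x)]).

Definition graded_hom (M N : lmodType R) (grM : int -> set M)
    (grN : int -> set N) (f : {linear M -> N}) : Prop :=
  forall j x, grM j x -> grN j (f x).

Definition graded_iso (M N : lmodType R) (grM : int -> set M)
    (grN : int -> set N) : Prop :=
  exists (f : {linear M -> N}) (h : {linear N -> M}),
    [/\ graded_hom grM grN f, graded_hom grN grM h, cancel f h & cancel h f].

Definition graded_injective (E : lmodType R) (grE : int -> set E) : Prop :=
  forall (M N : lmodType R) (grM : int -> set M) (grN : int -> set N)
         (i : {linear M -> N}) (f : {linear M -> E}),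
    graded_module grM -> graded_module grN ->
    graded_hom grM grN i -> injective i -> graded_hom grM grE f ->
    exists2 h : {linear N -> E}, graded_hom grN grE h & forall x, h (i x) = f x.

(* Injective resolutions in the category of graded modules. *)
Record inj_res (M : lmodType R) (grM : int -> set M) := InjRes {
  ir_mod :> nat -> lmodType R;
  ir_gr : forall i, int -> set (ir_mod i);
  ir_d : forall i, {linear ir_mod i -> ir_mod i.+1};
  ir_eps : {linear M -> ir_mod 0%N};
  ir_graded : forall i, graded_module (@ir_gr i);
  ir_injective : forall i, graded_injective (@ir_gr i);
  ir_d_hom : forall i, graded_hom (@ir_gr i) (@ir_gr i.+1) (ir_d i);
  ir_eps_hom : graded_hom grM (@ir_gr 0%N) ir_eps;
  ir_eps_inj : injective ir_eps;
  ir_exact0 : forall x, ir_d 0%N x = 0 <-> exists y, ir_eps y = x;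
  ir_exact : forall i x, ir_d i.+1 x = 0 <-> exists y, ir_d i y = x }.

(* The m-torsion functor: elements killed by a power of m. *)
Definition gamma (M : lmodType R) : {pred M} := fun x =>
  `[< exists k : nat, forall rs : seq R, size rs = k ->
        (forall r, r \in rs -> r \in irrelevant_ideal) ->
        (\prod_(r <- rs) r) *: x = 0 >].

Fact gamma_submod_closed (M : lmodType R) : submod_closed (@gamma M).
Proof.
split=> [|a x y /asboolP[k xk] /asboolP[l yl]]; apply/asboolP.
  by exists 0%N => rs _ _; rewrite scaler0.
exists (k + l)%N => rs srs mrs.
have x0 : (\prod_(r <- take k rs) r) *: x = 0.
  by apply: xk => [|r /mem_take/mrs //]; rewrite size_takel // srs leq_addr.
have y0 : (\prod_(r <- drop k rs) r) *: y = 0.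
  by apply: yl => [|r /mem_drop/mrs //]; rewrite size_drop srs addKn.
rewrite -(cat_take_drop k rs) big_cat /= scalerDr -[in X in _ + X]scalerA y0.
by rewrite scaler0 addr0 scalerA mulrC mulrCA mulrC -scalerA x0 scaler0.
Qed.
HB.instance Definition _ M :=
  GRing.isSubmodClosed.Build R M (@gamma M) (@gamma_submod_closed M).

Section LocalCohomology.
Variables (M : lmodType R) (grM : int -> set M) (E : inj_res grM).

Definition lc_cycles (n : nat) : {pred E n} :=
  [pred x | (x \in @gamma (E n)) && (ir_d E n x == 0)].
Fact lc_cycles_closed n : submod_closed (@lc_cycles n).
Proof.
split=> [|r x y]; rewrite !inE ?rpred0 ?raddf0 ?eqxx //.
move=> /andP[gx /eqP dx] /andP[gy /eqP dy].
by rewrite rpredD ?rpredZ // linearP dx dy scaler0 addr0 eqxx.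
Qed.
HB.instance Definition _ n :=
  GRing.isSubmodClosed.Build R (E n) (@lc_cycles n) (lc_cycles_closed n).

Definition lc_bounds (n : nat) : {pred E n} :=
  match n return {pred E n} with
  | 0%N => [pred x | x == 0]
  | k.+1 => fun x => `[< exists2 y, y \in @gamma (E k) & ir_d E k y = x >]
  end.
Fact lc_bounds_closed n : submod_closed (@lc_bounds n).
Proof.
case: n => [|n]; split=> [|r x y].
- by rewrite inE.
- by rewrite !inE => /eqP-> /eqP->; rewrite scaler0 addr0.
- by apply/asboolP; exists 0; rewrite ?rpred0 ?raddf0.
move=> /asboolP[x' gx <-] /asboolP[y' gy <-]; apply/asboolP.
by exists (r *: x' + y'); rewrite ?linearP // rpredD ?rpredZ.
Qed.
HB.instance Definition _ n :=
  GRing.isSubmodClosed.Build R (E n) (@lc_bounds n) (lc_bounds_closed n).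

(* H^n_m(M) = H^n(gamma E) with its grading *)
Definition lc (n : nat) : lmodType R := subquot (@lc_cycles n) (@lc_bounds n).
Definition lc_gr (n : nat) : int -> set (lc n) :=
  subquot_gr (@ir_gr _ _ E n).
Definition lc_class (n : nat) (z : submod (@lc_cycles n)) : lc n :=
  qmod_pi _ z.
End LocalCohomology.
Arguments lc_cycles {M grM} E n _.
Arguments lc_bounds {M grM} E n _.

(* The pairing identifies the graded module W with the graded [R]_0-dual of H,
   whose component of degree j is Hom([H]_(-j), [R]_0) and on which R acts by
   (r w)(h) = w(r h). *)
Record graded_dual (W H : lmodType R) (grW : int -> set W) (grH : int -> set H)
    (pr : W -> H -> R) : Prop := GradedDual {
  gd_val : forall w h, gr 0%N (pr w h);
  gd_Dl : forall w w' h, pr (w + w') h = pr w h + pr w' h;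
  gd_Dr : forall w h h', pr w (h + h') = pr w h + pr w h';
  gd_lin : forall k w h, gr 0%N k -> pr w (k *: h) = k * pr w h;
  gd_act : forall r w h, pr (r *: w) h = pr w (r *: h);
  gd_deg : forall i j w h, grW i w -> grH j h -> i + j != 0 -> pr w h = 0;
  gd_inj : forall j w, grW j w -> (forall h, grH (- j) h -> pr w h = 0) -> w = 0;
  gd_surj : forall j (phi : H -> R),
    (forall h, grH (- j) h -> gr 0%N (phi h)) ->
    (forall k h h', gr 0%N k -> grH (- j) h -> grH (- j) h' ->
       phi (k *: h + h') = k * phi h + phi h') ->
    exists2 w, grW j w & forall h, grH (- j) h -> pr w h = phi h }.

Definition ann (M : lmodType R) : {pred R^o} :=
  fun r => `[< forall x : M, (r : R) *: x = 0 >].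
Fact ann_submod_closed M : submod_closed (ann M).
Proof.
split=> [|r s t /asboolP s0 /asboolP t0]; apply/asboolP => x.
  by rewrite scale0r.
by rewrite scalerDl -scalerA s0 t0 scaler0 addr0.
Qed.
HB.instance Definition _ M :=
  GRing.isSubmodClosed.Build R R^o (ann M) (ann_submod_closed M).

(* W is a canonical module of M, where n = dim M. *)
Record canonical_module (M : lmodType R) (grM : int -> set M) (n : nat)
    (W : lmodType R) (grW : int -> set W) := CanonicalModule {
  cm_res : inj_res grM;
  cm_pr : W -> lc cm_res n -> R;
  cm_dim : dim_is (ann M) n;
  cm_graded : graded_module grW;
  cm_dual : graded_dual grW (lc_gr (E := cm_res) (n := n)) cm_pr }.

(* psi is the map of canonical modules induced by the map p : M -> N of modules
   of the same dimension n: it is dual to H^n_m(p), which is computed by a lift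
   theta of p to the injective resolutions. *)
Definition induced_canonical_hom (M N : lmodType R)
    (grM : int -> set M) (grN : int -> set N) (n : nat)
    (WM WN : lmodType R) (grWM : int -> set WM) (grWN : int -> set WN)
    (KM : canonical_module grM n grWM) (KN : canonical_module grN n grWN)
    (p : M -> N) (psi : WN -> WM) : Prop :=
  exists theta : forall i, {linear cm_res KM i -> cm_res KN i},
    [/\ forall i, graded_hom (@ir_gr _ _ (cm_res KM) i)
                             (@ir_gr _ _ (cm_res KN) i) (theta i),
        forall x, theta 0%N (ir_eps (cm_res KM) x) = ir_eps (cm_res KN) (p x),
        forall i x, theta i.+1 (ir_d (cm_res KM) i x) =
                    ir_d (cm_res KN) i (theta i x) &
        forall (w : WN) (z : submod (lc_cycles (cm_res KM) n))
               (z' : submod (lc_cycles (cm_res KN) n)),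
          val z' = theta n (val z) ->
          cm_pr (psi w) (lc_class z) = cm_pr w (lc_class z')].

Definition quot_gr (c : ideal R) : int -> set (qmod c) :=
  qmod_gr (zgr : int -> set R^o).
Arguments quot_gr c _ _ : clear implicits.

(* For c contained in a, with R/c and R/a Gorenstein of the same dimension n:
   after identifying the canonical modules of R/a and R/c with (R/a)(s) and
   (R/c)(t), the map between them induced by the projection R/c -> R/a is
   multiplication by omega. *)
Definition canonical_hom_is_mul (c a : ideal R) (omega : R) : Prop :=
  exists (n : nat) (s t : int)
         (Kc : canonical_module (quot_gr c) n (shift (quot_gr c) t))
         (Ka : canonical_module (quot_gr a) n (shift (quot_gr a) s))
         (p : {linear qmod c -> qmod a}) (psi : {linear qmod a -> qmod c}),
    [/\ forall x : R, p (qmod_pi c x) = qmod_pi a x,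
        forall x : R, psi (qmod_pi a x) = qmod_pi c (omega * x) &
        induced_canonical_hom Kc Ka p psi].

Definition linked (c I J : ideal R) : Prop :=
  [/\ [/\ homogeneous c, homogeneous I & homogeneous J], Gorenstein_ideal c,
      {subset c <= I} /\ {subset c <= J},
      colon c [set x | x \in I] =i J & colon c [set x | x \in J] =i I].

(* K is obtained from I by an elementary biliaison on J. *)
Definition elementary_biliaison (J I K : ideal R) : Prop :=
  [/\ [/\ homogeneous I, homogeneous J & homogeneous K],
      {subset J <= I} /\ {subset J <= K},
      exists n, ideal_grade J n /\ ideal_grade I n.+1,
      CM_ideal J /\ generically_Gorenstein J &
      exists s : int,
        graded_iso (shift (@subquot_gr _ I J (zgr : int -> set R^o)) (- s))
                   (@subquot_gr _ K J (zgr : int -> set R^o))].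

(* Graded free modules F_i = sum_p R(- tw i p), acting as columns, with maps
   d i : F_i -> F_(i-1) for i > 0; d 0 is junk. *)
Record free_complex := FreeComplex {
  rk : nat -> nat;
  tw : forall i, 'I_(rk i) -> int;
  fd : forall i, 'M[R]_(rk i.-1, rk i) }.

(* Graded minimal free resolution 0 -> R(-t) -> F_(n-1) -> ... -> F_1 -> R
   of R/c. *)
Record minimal_res (c : ideal R) (n : nat) (t : int) := MinimalRes {
  mr_cpx :> free_complex;
  mr_deg : forall i p q, (0 < i)%N ->
    zgr (@tw mr_cpx i q - @tw mr_cpx i.-1 p) (fd mr_cpx i p q);
  mr_cplx : forall i, fd mr_cpx i.+1 *m fd mr_cpx i.+2 = 0;
  mr_exact : forall i (x : 'cV_(rk mr_cpx i.+1)),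
    fd mr_cpx i.+1 *m x = 0 -> exists z, x = fd mr_cpx i.+2 *m z;
  mr_image : forall x, x \in c <->
    exists z : 'cV_(rk mr_cpx 1), forall p, (fd mr_cpx 1 *m z) p 0 = x;
  mr_rk0 : rk mr_cpx 0 = 1%N;
  mr_tw0 : forall p, @tw mr_cpx 0 p = 0;
  mr_rkn : rk mr_cpx n = 1%N;
  mr_twn : forall p, @tw mr_cpx n p = t;
  mr_len : forall i, (n < i)%N -> rk mr_cpx i = 0%N;
  mr_min : forall i p q, (0 < i)%N -> fd mr_cpx i p q \in irrelevant_ideal }.

Definition mr_top c n t (F : minimal_res c n t) : 'I_(rk F n) :=
  cast_ord (esym (mr_rkn F)) ord0.

(* A degree-preserving chain map F -> G lifting the projection of the resolved
   cyclic modules, i.e. the identity in homological degree 0. *)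
Record comparison_map (F G : free_complex)
    (alpha : forall i, 'M[R]_(rk G i, rk F i)) : Prop := ComparisonMap {
  cp_deg : forall i p q, zgr (@tw F i q - @tw G i p) (alpha i p q);
  cp_comm : forall i, fd G i.+1 *m alpha i.+1 = alpha i *m fd F i.+1;
  cp_id : forall p q, alpha 0%N p q = 1 }.

End Graded.
Arguments comparison_map {R} gr F G alpha.

Definition row_set (R : comNzRingType) (m : nat) (v : 'rV[R]_m) : set R :=
  [set v 0 p | p in [set: 'I_m]].

(* Main.v *)
Require Import Defs.
From HB Require Import structures.
From mathcomp Require Import all_boot all_order all_algebra.
From mathcomp Require Import ring_quotient boolp classical_sets.
From mathcomp Require Import ring.
Set Implicit Arguments.
Unset Strict Implicit.
Unset Printing Implicit Defensive.

Import GRing.Theory.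
Local Open Scope classical_set_scope.
Local Open Scope ring_scope.

(** Write [z = omega + f * y].  The ideal [J] is a common link: [a] is
    [(b, y) : J] and [I] is [(b, z) : J], while [y] and [z] lie in [J] and are
    nonzerodivisors modulo [b].  In the total quotient ring of [R/b] this says
    that [a = y J^-1] and [I = z J^-1], where [J^-1] denotes the elements
    carrying [J] into [R/b].  Hence [I = (z/y) a], and multiplication by the
    fraction [z/y], which has degree [d], is the isomorphism from [(a/b)(-d)]
    to [I/b] which a biliaison on [b] asks for.

    Fractions are avoided by working with the relation [y * x' - z * x \in b],
    which says that [x'] represents [(z/y) x].  Since [J] treats the pairs
    [(a, y)] and [(I, z)] alike, every statement about this relation is proved
    once and used in both directions: [colon_fraction] provides [x'] in [I] for
    each [x] in [a], [fraction_map] turns the relation into a linear map of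
    quotients, and [homogeneous_fraction] shows that [x'] can be taken
    homogeneous when [x] is, so that the map respects degrees.  The two maps
    obtained are inverse to each other because the relations defining them are.
    That [b] is Cohen-Macaulay and generically Gorenstein follows from [R/b]
    being Gorenstein. *)

(** * Fractions modulo an ideal *)

Section Fractions.
Context {R : comNzRingType}.
Implicit Types (a b I J : ideal R) (x y z r : R).

Lemma idealM I r x : x \in I -> r * x \in I.
Proof. exact: (rpredZ (s := I) r). Qed.

Lemma ideal_add I x y : x \in I -> y \in I -> x + y \in I.
Proof. exact: (rpredD (S := I)). Qed.

Lemma idealN I x : x \in I -> - x \in I.
Proof. by rewrite -mulN1r; apply: idealM. Qed.

Lemma idealB I x y : x \in I -> y \in I -> x - y \in I.
Proof. by move=> xI /idealN; apply: ideal_add. Qed.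

Lemma ideal_addr I x y : y - x \in I -> x \in I -> y \in I.
Proof. by move=> yxI xI; rewrite -(subrK x y); apply: ideal_add. Qed.

(** The ideal [b + y R] given by its elements, whereas [idealD] is an
    intersection of ideals. *)
Definition add_principal b y : {pred R^o} :=
  fun x => `[< exists t : R, (x : R) - y * t \in b >].

Fact add_principal_submod_closed b y : submod_closed (add_principal b y).
Proof.
split=> [|r x x' /asboolP[t xt] /asboolP[t' xt']]; apply/asboolP.
  by exists 0; rewrite mulr0 subr0; apply: (rpred0 b).
exists (r * t + t'); move: (ideal_add (idealM r xt) xt').
have lin (v v' : R) : r * (v - y * t) + (v' - y * t') =
    r * v + v' - y * (r * t + t') by ring.
by rewrite lin.
Qed.
HB.instance Definition _ b y :=
  GRing.isSubmodClosed.Build R R^o (add_principal b y)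
    (add_principal_submod_closed b y).

Lemma mem_idealD1 b y x :
  x \in idealD b [set y] <-> exists t, x - y * t \in b.
Proof.
split=> [/asboolP xS | [t xt]].
  suff /asboolP : x \in add_principal b y by [].
  apply: xS => w [wb | ->]; apply/asboolP; first by exists 0; rewrite mulr0 subr0.
  by exists 1; rewrite mulr1 subrr; apply: (rpred0 b).
apply/asboolP => N SN; apply: (@ideal_addr N (y * t)).
  by apply: SN; left.
by rewrite mulrC; apply: idealM; apply: SN; right.
Qed.

Definition regular_mod b y := forall x, y * x \in b -> x \in b.

Lemma colon_regular b y : colon b [set y] =i b -> regular_mod b y.
Proof.
move=> by_b x xb; rewrite -by_b; apply/asboolP => _ ->.
by rewrite mulrC.
Qed.

Lemma fraction_lin b y z r x1 x1' x2 x2' :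
    y * x1' - z * x1 \in b -> y * x2' - z * x2 \in b ->
  y * (r * x1' + x2') - z * (r * x1 + x2) \in b.
Proof.
move=> x1P x2P; move: (ideal_add (idealM r x1P) x2P).
by congr (_ \in b); ring.
Qed.

Lemma fraction_uniq b y z x1 x1' x2 x2' :
    regular_mod b y -> y * x1' - z * x1 \in b -> y * x2' - z * x2 \in b ->
  x1 - x2 \in b -> x1' - x2' \in b.
Proof.
move=> y_reg x1P x2P x12; apply: y_reg.
move: (ideal_add (idealB x1P x2P) (idealM z x12)).
by congr (_ \in b); ring.
Qed.

(** With [a = y J^-1] and [I = z J^-1] modulo [b], the fraction [z/y] carries
    [a] into [I]: the element [z * x] is a multiple [y * x'] because [z] is in
    [J], and then [x' J] is in [z R] because [y x' J = z x J] is in [z y R],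
    where [y] can be cancelled. *)
Lemma colon_fraction a b I J y z :
    regular_mod b y -> z \in J ->
    colon (idealD b [set y]) [set x | x \in J] =i a ->
    colon (idealD b [set z]) [set x | x \in J] =i I ->
  forall x, x \in a -> exists2 x', x' \in I & y * x' - z * x \in b.
Proof.
move=> y_reg zJ aE IE x; rewrite -aE => /asboolP xJ.
have /mem_idealD1[x' x'P] := xJ z zJ.
have x'x : y * x' - z * x \in b.
  by rewrite -opprB; apply: idealN; rewrite mulrC.
exists x' => //; rewrite -IE; apply/asboolP => j jJ.
have /mem_idealD1[t tP] := xJ j jJ.
apply/mem_idealD1; exists t; apply: y_reg.
have -> : y * (x' * j - z * t) = j * (y * x' - z * x) + z * (x * j - y * t).
  by ring.
by apply: ideal_add; apply: idealM.
Qed.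

(** The relation [y * x' - z * x \in b] determines [x'] modulo [b], and carries
    [b] into [b], because [y] is regular modulo [b]; so it is the graph of a
    map, which is linear because the relation is. *)
Lemma fraction_map a b I y z :
    regular_mod b y ->
    (forall x, x \in a -> exists2 x', x' \in I & y * x' - z * x \in b) ->
  exists F : {linear subquot a b -> subquot I b},
    forall (x : submod a) (x' : submod I),
      y * (val x' : R) - z * (val x : R) \in b ->
      F (qmod_pi _ x) = qmod_pi _ x'.
Proof.
move=> y_reg frac.
have frac' (x : submod a) :
    exists x' : submod I, y * (val x' : R) - z * (val x : R) \in b.
  have [x' x'I x'P] := frac (val x) (valP x).
  by exists (exist _ x' x'I).
have [phi phiP] := choice frac'.
pose F (q : subquot a b) : subquot I b :=
  qmod_pi _ (phi (repr (q : @Quotient.quot _ (zpred (trace a b))))).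
have FE (x : submod a) (x' : submod I) :
    y * (val x' : R) - z * (val x : R) \in b -> F (qmod_pi _ x) = qmod_pi _ x'.
  move=> x'P; rewrite /F; set r := repr _.
  have rx : (val r : R) - val x \in b.
    have: r - x \in trace a b by rewrite -qmod_piE /qmod_pi /r reprK.
    by [].
  apply/eqP; rewrite qmod_piE.
  exact: (fraction_uniq y_reg (phiP r) x'P rx).
have F_lin : linear F.
  move=> r; elim/qmod_pi_ind=> x1; elim/qmod_pi_ind=> x2.
  rewrite -linearP (FE x1 _ (phiP x1)) (FE x2 _ (phiP x2)) -linearP.
  exact/FE/(fraction_lin r (phiP x1) (phiP x2)).
pose Fl : {linear subquot a b -> subquot I b} :=
  HB.pack F (GRing.isLinear.Build _ _ _ _ F F_lin).
by exists Fl => x x'; apply: FE.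
Qed.

End Fractions.

(** * Homogeneous components *)

Section Components.
Context {R : comNzRingType} {gr : nat -> set R} (hgr : standard_graded gr).
Implicit Types (b : ideal R) (x y z : R) (xc : int -> R).

Let gr_R : grading (zgr gr) := sg_grading hgr.

Lemma zgr_add j x y : zgr gr j x -> zgr gr j y -> zgr gr j (x + y).
Proof.
move=> xj yj; rewrite -[y]opprK -[- y]sub0r.
by do 2!apply: (gr_B gr_R) => //; apply: (gr_0 gr_R).
Qed.

Lemma zgr_M i j x y : gr i x -> zgr gr j y -> zgr gr (i%:Z + j) (x * y).
Proof.
case: j => [j|j] xi; first exact: (sg_M hgr).
by move=> ->; rewrite mulr0; apply: (gr_0 gr_R).
Qed.

(** [xc] lists the homogeneous components of [x].  The vanishing outside a
    finite support makes the list unique. *)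
Definition components x xc : Prop :=
  (forall j, zgr gr j (xc j)) /\
  exists2 s : seq int, uniq s &
    (forall j, j \notin s -> xc j = 0) /\ x = \sum_(j <- s) xc j.

Lemma sum_support (s t : seq int) xc :
    uniq s -> uniq t -> {subset s <= t} -> (forall j, j \notin s -> xc j = 0) ->
  \sum_(j <- t) xc j = \sum_(j <- s) xc j.
Proof.
move=> s_uniq t_uniq st xc0; rewrite (bigID (mem s)) /=.
rewrite [X in _ + X]big1 ?addr0 => [|j /xc0 //].
rewrite -big_filter; apply: perm_big.
apply: uniq_perm => [||j]; rewrite ?filter_uniq //.
by rewrite mem_filter andb_idr // => /st.
Qed.

(** The sums furnished by [grading] and [homogeneous] may list a degree several
    times, so equal degrees have to be collected. *)
Lemma components_sum (s : seq int) xc :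
    (forall j, zgr gr j (xc j)) ->
  components (\sum_(j <- s) xc j) (fun j => xc j *+ count_mem j s).
Proof.
move=> xcP; split=> [j|].
  elim: (count_mem j s) => [|n IHn]; first exact: (gr_0 gr_R).
  by rewrite mulrS; apply: zgr_add.
exists (undup s); rewrite ?undup_uniq //; split=> [j|].
  by rewrite mem_undup => /count_memPn->.
by rewrite -big_undup_iterop_count.
Qed.

Lemma ex_components x : exists xc, components x xc.
Proof.
by have [s [xc [xcP ->]]] := gr_span gr_R x; eexists; apply: components_sum.
Qed.

Lemma homogeneous_components b x : homogeneous gr b -> x \in b ->
  exists2 xc, components x xc & forall j, xc j \in b.
Proof.
move=> b_hom /b_hom[s [xc [xcP xcb ->]]].
eexists; first exact: components_sum.
by move=> j /=; rewrite -mulr_natl; apply: idealM.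
Qed.

Lemma componentsB x y xc yc : components x xc -> components y yc ->
  components (x - y) (fun j => xc j - yc j).
Proof.
move=> [xcP [s s_uniq [xc0 ->]]] [ycP [t t_uniq [yc0 ->]]].
split=> [j|]; first exact: (gr_B gr_R).
exists (undup (s ++ t)); first exact: undup_uniq.
split=> [j|].
  by rewrite mem_undup mem_cat => /norP[/xc0-> /yc0->]; rewrite subr0.
rewrite sumrB; congr (_ - _); symmetry; apply: sum_support;
  rewrite ?undup_uniq // => j; rewrite mem_undup mem_cat => ->; rewrite ?orbT //.
Qed.

Lemma componentsM i y x xc : gr i y -> components x xc ->
  components (y * x) (fun j => y * xc (j - i%:Z)).
Proof.
move=> yi [xcP [s s_uniq [xc0 ->]]]; split=> [j|].
  by rewrite -[j in zgr _ j](subrKC i%:Z); apply: zgr_M.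
exists [seq i%:Z + j | j <- s]; first by rewrite map_inj_uniq //; apply: addrI.
split=> [j js|].
  rewrite xc0 ?mulr0 //; apply: contra js => js.
  by rewrite -[j](subrKC i%:Z); apply: map_f.
by rewrite big_map mulr_sumr; apply: eq_bigr => j _; rewrite addrC addKr.
Qed.

Lemma components_homogeneous k x : zgr gr k x ->
  components x (fun j => if j == k then x else 0).
Proof.
move=> xk; split=> [j|]; first by case: eqP => [->|_] //; apply: (gr_0 gr_R).
exists [:: k] => //; split=> [j|]; first by rewrite inE => /negPf->.
by rewrite big_seq1 eqxx.
Qed.

Lemma components_uniq x xc yc :
  components x xc -> components x yc -> xc =1 yc.
Proof.
move=> xcP /(componentsB xcP)[dP [s s_uniq [d0 /esym]]].
rewrite subrr => /(gr_free gr_R s_uniq dP) ds j; apply/eqP; rewrite -subr_eq0.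
by apply/eqP; case: (boolP (j \in s)) => [/ds | /d0].
Qed.

(** In the relation [y * x' - z * x \in b] with [x], [y], [z] and [b]
    homogeneous, only one component of [x'] matters, and the others may be
    dropped. *)
Lemma homogeneous_fraction b (ey ez : nat) (k : int) x x' y z :
    homogeneous gr b -> gr ey y -> gr ez z -> zgr gr k x ->
    y * x' - z * x \in b ->
  exists2 x'', zgr gr (k + ez%:Z - ey%:Z) x'' & y * x'' - z * x \in b.
Proof.
move=> b_hom yP zP xP /(homogeneous_components b_hom)[bc bcP bcb].
have [xc xcP] := ex_components x'.
have zxP : zgr gr (k + ez%:Z) (z * x) by rewrite addrC; apply: zgr_M.
have cP := componentsB (componentsM yP xcP)
                               (components_homogeneous zxP).
exists (xc (k + ez%:Z - ey%:Z)); first by case: xcP.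
have := bcb (k + ez%:Z); rewrite (components_uniq bcP cP) eqxx.
by [].
Qed.

End Components.

(** * The biliaison *)

(** The linear map of degree [ez - ey] from [a/b] to [I/b] given by the fraction
    [z/y].  The homogeneous representative [x''] of [(z/y) x] is in [I] because
    it agrees modulo [b] with one that is. *)
Lemma graded_fraction_map (R : comNzRingType) (gr : nat -> set R)
    (a b I : ideal R) (ey ez : nat) (y z : R) :
    standard_graded gr -> homogeneous gr b -> {subset b <= I} ->
    gr ey y -> gr ez z -> regular_mod b y ->
    (forall x, x \in a -> exists2 x', x' \in I & y * x' - z * x \in b) ->
  exists2 F : {linear subquot a b -> subquot I b},
    (forall (x : submod a) (x' : submod I),
      y * (val x' : R) - z * (val x : R) \in b ->
      F (qmod_pi _ x) = qmod_pi _ x') &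
    forall k q, @subquot_gr R R^o a b (zgr gr) k q ->
      @subquot_gr R R^o I b (zgr gr) (k + ez%:Z - ey%:Z) (F q).
Proof.
move=> hgr b_hom bI yP zP y_reg frac.
have [F FE] := fraction_map y_reg frac; exists F => // k q [x xk <-].
have [x' x'I x'P] := frac (val x) (valP x).
have [x'' x''k x''P] := homogeneous_fraction hgr b_hom yP zP xk x'P.
have x''I : x'' \in I.
  apply: ideal_addr x'I; apply/bI/(fraction_uniq y_reg x''P x'P).
  by rewrite subrr; apply: (rpred0 b).
exists (exist _ x'' x''I : submod I) => //.
by rewrite (FE x (exist _ x'' x''I)).
Qed.

Theorem proposition4p3 (R : comNzRingType) (gr : nat -> set R)
  (hgr : standard_graded gr) (hnoeth : noetherian R)
  (hGor : Gorenstein_quotient (zero_ideal R))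
  (g : nat) (g_gt0 : (0 < g)%N) (a b : ideal R)
  (a_hom : homogeneous gr a) (b_hom : homogeneous gr b)
  (a_Gor : Gorenstein_ideal a) (b_Gor : Gorenstein_ideal b)
  (a_grade : ideal_grade a g)
  (b_grade : ideal_grade b g.-1)
  (b_sub_a : {subset b <= a})
  (u v : int)
  (A : minimal_res gr a g v) (B : minimal_res gr b g.-1 u)
  (alpha : forall i, 'M[R]_(rk A i, rk B i))
  (alpha_comparison : comparison_map gr B A alpha)
  (d : nat) (d_eq : u - v = d%:Z)
  (e : nat) (y : R) (y_in_a : y \in a) (y_deg : gr e y)
  (y_reg : colon b [set y] =i b)
  (omega : R) (omega_deg : gr (d + e)%N omega)
  (omega_mul : canonical_hom_is_mul gr (idealD b [set y]) a omega)
  (f : R) (f_deg : gr d f)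
  (z_reg : colon b [set omega + f * y] =i b)
  (J I : ideal R)
  (link1 : linked gr (idealD b [set y]) a J)
  (link2 : linked gr (idealD b [set omega + f * y]) J I)
  (I_eq : I =i idealD b (row_set
     (row (mr_top B) (alpha g.-1)^T +
      ((-1) ^+ g * f) *: row (mr_top A) (fd A g)^T))) :
  elementary_biliaison gr b a I.
Proof.
case: link1 => _ _ [_ cJ] _ aE.
case: link2 => -[_ _ I_hom] _ [c'J c'I] IE _.
set z := omega + f * y in z_reg c'J c'I IE.
have b_idealD w : {subset b <= idealD b [set w]}.
  by move=> x xb; apply/mem_idealD1; exists 0; rewrite mulr0 subr0.
have mem_self w : w \in idealD b [set w].
  by apply/mem_idealD1; exists 1; rewrite mulr1 subrr; apply: (rpred0 b).
have b_sub_I : {subset b <= I} by move=> x /(b_idealD z)/c'I.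
have z_deg : gr (d + e)%N z.
  by apply: (zgr_add hgr (j := (d + e)%N)) => //; apply: (sg_M hgr).
have yR := colon_regular y_reg; have zR := colon_regular z_reg.
have a_to_I := colon_fraction yR (c'J _ (mem_self z)) aE IE.
have I_to_a := colon_fraction zR (cJ _ (mem_self y)) IE aE.
have [F FE F_gr] := graded_fraction_map hgr b_hom b_sub_I y_deg z_deg yR a_to_I.
have [G GE G_gr] := graded_fraction_map hgr b_hom b_sub_a z_deg y_deg zR I_to_a.
have b_loc P : prime_ideal P -> {subset b <= P} ->
    localizations_satisfy b P local_Gorenstein.
  by move=> P_prime bP; case: b_Gor => _; apply.
split=> //.
- by exists g.-1; rewrite prednK.
- split=> [P P_prime bP S phi /(b_loc P P_prime bP)[] // |].
  by move=> P [P_prime bP _]; apply: b_loc.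
exists d%:Z, F, G; split.
- move=> j q /F_gr; rewrite PoszD addrA addrK addrAC addNr add0r.
  exact.
- move=> j q /G_gr; rewrite PoszD opprD addrA addrAC addrK addrC.
  exact.
- elim/qmod_pi_ind=> x; have [x' x'I x'P] := a_to_I (val x) (valP x).
  rewrite (FE x (exist _ x' x'I)) //; apply: GE => /=.
  by rewrite -opprB; apply: idealN.
elim/qmod_pi_ind=> x'; have [x xa xP] := I_to_a (val x') (valP x').
rewrite (GE x' (exist _ x xa)) //; apply: FE => /=.
by rewrite -opprB; apply: idealN.
Qed.
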